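(* If $G\in\mathbb{C}^{m\times m}$ is positive definite, $\alpha\in\mathbb{D}\setminus\{0\}$ and $\alpha_\circ=1/\overline{\alpha}$, then the following statements are equivalent: (1) $G$ is a block Toeplitz matrix. (2) The isometry $\langle S_\alpha f,S_\alpha f\rangle_{\mathcal{H}_G}=\langle f,f\rangle_{\mathcal{H}_G}$ holds for every $f\in(\mathcal{H}_G)_\alpha$. (3) $(1-\lambda\overline{\alpha})(1-\alpha\overline{\omega})F(\lambda)N_\alpha F(\omega)^*=(\lambda-\alpha)(\overline{\omega}-\overline{\alpha})F(\lambda)N_{\alpha_\circ}F(\omega)^*$ for all $\lambda,\omega\in\mathbb{C}$. (4) $(1-\lambda\overline{\alpha})F(\lambda)N_\alpha(I_m-\overline{\alpha}A^* )^{-1}=-(\lambda-\alpha)F(\lambda)N_{\alpha_\circ}(\alpha I_m-A^* )^{-1}$ for all $\lambda\in\mathbb{C}$. (5) $(\overline{\alpha}I_m-A)N_\alpha(\alpha I_m-A^* )=(I_m-\alpha A)N_{\alpha_\circ}(I_m-\overline{\alpha}A^* )$. Moreover, the identities (3) (for all $\lambda,\omega\in\mathbb{C}$), (4) (for all $\lambda\in\mathbb{C}$) and (5) are equivalent for every choice of $\alpha\in\mathbb{C}\setminus\{0\}$.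
   Context: $\mathbb{D}$ is the open unit disc. $p,n\ge1$ are fixed integers, $m=(n+1)p$, $F(\lambda)=\begin{bmatrix}I_p&\lambda I_p&\cdots&\lambda^nI_p\end{bmatrix}$, $\Gamma=G^{-1}$. $G$ has $p\times p$ blocks $g_{ij}$, $i,j=0,\ldots,n$, and is block Toeplitz if $g_{ij}$ depends only on $i-j$. $A\in\mathbb{C}^{m\times m}$ is the block matrix with $I_p$ in the block positions $(j,j+1)$, $j=0,\ldots,n-1$, and zeros elsewhere. $\mathcal{H}_G=\{Fu:u\in\mathbb{C}^m\}$ with inner product $\langle Fu,Fv\rangle_{\mathcal{H}_G}=v^*Gu$, and $(\mathcal{H}_G)_\alpha=\{f\in\mathcal{H}_G:f(\alpha)=0\}$. $(R_\alpha f)(\lambda)=\frac{f(\lambda)-f(\alpha)}{\lambda-\alpha}$ for $\lambda\ne\alpha$, $(R_\alpha f)(\alpha)=f'(\alpha)$, and $S_\alpha=-\overline{\alpha}I+(1-|\alpha|^2)R_\alpha$. For $\beta\in\mathbb{C}$, $\mathfrak{z}_\beta=\Gamma F(\beta)^*(F(\beta)\Gamma F(\beta)^* )^{-1/2}$ and $N_\beta=\Gamma-\mathfrak{z}_\beta\mathfrak{z}_\beta^*$. *)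

(* Defs.v *)
From mathcomp Require Import all_boot all_order all_algebra.
From mathcomp Require Import complex.
From mathcomp Require Import all_classical all_reals all_analysis.
Set Implicit Arguments.
Unset Strict Implicit.
Unset Printing Implicit Defensive.
Import Order.TTheory GRing.Theory Num.Theory.
Import numFieldNormedType.Exports.
Local Open Scope classical_set_scope.
Local Open Scope ring_scope.
Local Open Scope sesquilinear_scope.

(* The dimension m = (n+1)p is written \sum_(j < n.+1) p, the form in which
   the block-matrix operations of matrix.v produce it. *)
Notation bdim p n := (\sum_(j < n.+1) p)%N.

Definition posdefmx (C : numClosedFieldType) (k : nat) (M : 'M[C]_k) : Prop :=
  M \is hermsymmx /\
  forall u : 'cV[C]_k, u != 0 -> 0 < (u ^t* *m M *m u) 0 0.

(* M^(-1/2) by the spectral calculus: for M = U^* diag(d) U with U unitary it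
   is U^* diag(d^(-1/2)) U. *)
Definition invsqrtmx (C : numClosedFieldType) (k : nat) (M : 'M[C]_k)
    : 'M[C]_k :=
  (spectralmx M) ^t* *m
  diag_mx (map_mx (fun x : C => (sqrtC x)^-1) (spectral_diag M)) *m
  spectralmx M.

Definition Fmx (C : numClosedFieldType) (p n : nat) (lam : C)
    : 'M[C]_(p, bdim p n) :=
  \mxrow_(j < n.+1) ((lam ^+ j)%:M : 'M[C]_p).

Definition shiftmx (C : numClosedFieldType) (p n : nat) : 'M[C]_(bdim p n) :=
  \mxblock_(i < n.+1, j < n.+1)
     (if j == i.+1 :> nat then 1%:M else 0 : 'M[C]_p).

Definition block_toeplitz (C : numClosedFieldType) (p n : nat)
    (G : 'M[C]_(bdim p n)) : Prop :=
  exists t : int -> 'M[C]_p,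
    forall i j : 'I_n.+1, submxblock G i j = t (i%:Z - j%:Z).

Definition Hfun (C : numClosedFieldType) (p n : nat) (u : 'cV[C]_(bdim p n))
    : C -> 'cV[C]_p :=
  fun lam => Fmx p n lam *m u.

Definition HG (C : numClosedFieldType) (p n : nat) : set (C -> 'cV[C]_p) :=
  [set f | exists u : 'cV[C]_(bdim p n), f = Hfun u].

Definition HG_at (C : numClosedFieldType) (p n : nat) (alpha : C)
    : set (C -> 'cV[C]_p) :=
  [set f | HG n f /\ f alpha = 0].

(* The coefficient vector u of f = F u; unique by Hfun_inj below. *)
Definition Hcoef (C : numClosedFieldType) (p n : nat) (f : C -> 'cV[C]_p)
    : 'cV[C]_(bdim p n) :=
  xget 0 [set u | f = Hfun u].

Definition Hdot (C : numClosedFieldType) (p n : nat) (G : 'M[C]_(bdim p n))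
    (f g : C -> 'cV[C]_p) : C :=
  ((Hcoef n g) ^t* *m G *m Hcoef n f) 0 0.

Definition Rop (C : numClosedFieldType) (p : nat) (alpha : C)
    (f : C -> 'cV[C]_p) : C -> 'cV[C]_p :=
  fun lam => if lam == alpha then derive1 f alpha
             else (lam - alpha)^-1 *: (f lam - f alpha).

Definition Sop (C : numClosedFieldType) (p : nat) (alpha : C)
    (f : C -> 'cV[C]_p) : C -> 'cV[C]_p :=
  fun lam => - alpha^* *: f lam + (1 - `|alpha| ^+ 2) *: Rop alpha f lam.

Definition zmx (C : numClosedFieldType) (p n : nat) (G : 'M[C]_(bdim p n))
    (beta : C) : 'M[C]_(bdim p n, p) :=
  let Gamma := invmx G in
  let F := Fmx p n beta in
  Gamma *m F ^t* *m invsqrtmx (F *m Gamma *m F ^t*).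

Definition Nmx (C : numClosedFieldType) (p n : nat) (G : 'M[C]_(bdim p n))
    (beta : C) : 'M[C]_(bdim p n) :=
  invmx G - zmx G beta *m (zmx G beta) ^t*.

Lemma HfunE (C : numClosedFieldType) (p n : nat) (u : 'cV[C]_(bdim p n))
    (lam : C) :
  Hfun u lam = \sum_(j < n.+1) lam ^+ j *: submxcol u j.
Proof.
rewrite /Hfun /Fmx -[u in LHS]submxcolK mul_mxrow_mxcol.
by apply: eq_bigr => j _; rewrite mul_scalar_mx.
Qed.

Lemma poly_fun_eq0 (C : numClosedFieldType) (q : {poly C}) :
  (forall x, q.[x] = 0) -> q = 0.
Proof.
move=> q0; apply/eqP; apply/negPn/negP => qN0.
have := @max_poly_roots C q [seq i%:R | i <- iota 0 (size q)] qN0.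
rewrite size_map size_iota ltnn => H; suff: false by [].
apply: H; first by apply/allP => x _; exact/rootP/q0.
rewrite map_inj_uniq ?iota_uniq// => i j /eqP.
by rewrite eqr_nat => /eqP.
Qed.

Lemma Hfun_inj (C : numClosedFieldType) (p n : nat) :
  injective (@Hfun C p n).
Proof.
move=> u v uv; apply/mxcolP => j; apply/matrixP => i k; rewrite ord1 {k}.
pose q := \poly_(l < n.+1) (submxcol u (inord l) i 0 - submxcol v (inord l) i 0).
suff /(congr1 (fun q : {poly C} => q`_j)) : q = 0.
  rewrite coef_poly ltn_ord inord_val coef0 => /eqP.
  by rewrite subr_eq0 => /eqP.
apply: poly_fun_eq0 => x; rewrite horner_poly.
have /(congr1 (fun f : C -> 'cV[C]_p => f x i 0)) := uv.
rewrite !HfunE !summxE => /eqP; rewrite -subr_eq0 -sumrB => /eqP E.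
apply: etrans E; apply: eq_bigr => l _.
by rewrite inord_val !mxE mulrBl mulrC [X in _ - X]mulrC.
Qed.

Lemma HfunK (C : numClosedFieldType) (p n : nat) (u : 'cV[C]_(bdim p n)) :
  Hcoef n (Hfun u) = u.
Proof.
by rewrite /Hcoef; case: xgetP => [v _ /= /Hfun_inj ->//|/(_ u)/(_ erefl)].
Qed.

Lemma HdotE (C : numClosedFieldType) (p n : nat) (G : 'M[C]_(bdim p n))
    (u v : 'cV[C]_(bdim p n)) :
  Hdot G (Hfun u) (Hfun v) = (v ^t* *m G *m u) 0 0.
Proof. by rewrite /Hdot !HfunK. Qed.

Lemma HG_lin (C : numClosedFieldType) (p n : nat) (a : C)
    (f g : C -> 'cV[C]_p) :
  HG n f -> HG n g -> HG n (fun lam => a *: f lam + g lam).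
Proof.
move=> [u ->] [v ->]; exists (a *: u + v); apply/funext => x.
by rewrite /Hfun mulmxDr -scalemxAr.
Qed.

Lemma HG0 (C : numClosedFieldType) (p n : nat) :
  HG n (fun=> 0 : 'cV[C]_p).
Proof. by exists 0; apply/funext => x; rewrite /Hfun mulmx0. Qed.

Lemma HG_sum (C : numClosedFieldType) (p n : nat) (I : finType) (a : I -> C)
    (f : I -> C -> 'cV[C]_p) :
  (forall i, HG n (f i)) -> HG n (fun lam => \sum_i a i *: f i lam).
Proof.
move=> fH.
suff H (s : seq I) : HG n (fun lam => \sum_(i <- s) a i *: f i lam) by apply: H.
elim: s => [|i s IH].
  under [fun _ => _]funext do rewrite big_nil.
  exact: HG0.
under [fun _ => _]funext do rewrite big_cons.
exact: HG_lin.
Qed.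

Lemma HG_monom (C : numClosedFieldType) (p n k : nat) (w : 'cV[C]_p) :
  (k < n.+1)%N -> HG n (fun lam => lam ^+ k *: w).
Proof.
move=> kn; exists (\mxcol_(j < n.+1) (if j == k :> nat then w else 0)).
apply/funext => x; rewrite HfunE (bigD1 (Ordinal kn))//= mxcolK eqxx.
rewrite big1 ?addr0// => j jk; rewrite mxcolK; case: eqP => [e|]; last first.
  by rewrite scaler0.
by case/eqP: jk; apply/val_inj.
Qed.

Lemma cvg_HG (C : numClosedFieldType) (p n : nat) (f : C -> 'cV[C]_p)
    (T : Type) (F : set_system T) (FF : Filter F) (h : T -> C) (x : C) :
  HG n f -> h t @[t --> F] --> x -> f (h t) @[t --> F] --> f x.
Proof.
move=> [u ->] hx.
have powc (k : nat) : h t ^+ k @[t --> F] --> x ^+ k.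
  elim: k => [|k IHk].
    rewrite expr0 (_ : (fun t => h t ^+ 0) = cst 1); first exact: cvg_cst.
    by apply/funext => y; rewrite expr0.
  rewrite exprS (_ : (fun t => h t ^+ k.+1) = fun t => h t * h t ^+ k).
    exact: cvgM.
  by apply/funext => y; rewrite exprS.
rewrite HfunE (_ : (fun t => Hfun u (h t)) =
  fun t => \sum_(j < n.+1) h t ^+ j *: submxcol u j); last first.
  by apply/funext => y; rewrite HfunE.
elim: (index_enum _) => [|j s IH].
  rewrite big_nil (_ : (fun t : T => _) = cst 0); first exact: cvg_cst.
  by apply/funext => y; rewrite big_nil.
rewrite big_cons (_ : (fun t : T => _) = fun t : T =>
  h t ^+ j *: submxcol u j + \sum_(i <- s) h t ^+ i *: submxcol u i).
  by apply: cvgD => //; apply: cvgZr_tmp; exact: powc.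
by apply/funext => y; rewrite big_cons.
Qed.

Lemma Rop_quotient (C : numClosedFieldType) (p n : nat) (alpha : C)
    (f g : C -> 'cV[C]_p) :
  HG n g -> (forall lam, f lam - f alpha = (lam - alpha) *: g lam) ->
  Rop alpha f = g.
Proof.
move=> gH fg; apply/funext => x; rewrite /Rop; case: eqP => [->|/eqP xa].
  rewrite /derive1; apply/cvg_lim; first exact: norm_hausdorff.
  have gc : g (h + alpha) @[h --> (0 : C)^'] --> g alpha.
    apply: (cvg_HG _ gH).
    rewrite -[X in _ --> X]add0r; apply: cvgD; last exact: cvg_cst.
    exact: nbhs_dnbhs.
  apply: cvg_trans gc; apply: near_eq_cvg; near=> h.
  have hN0 : h != 0 by near: h; exact: nbhs_dnbhs_neq.
  by rewrite /= fg addrK scalerA mulVf// scale1r.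
by rewrite fg scalerA mulVf ?scale1r// subr_eq0.
Unshelve. all: by end_near.
Qed.

Lemma HG_Rop (C : numClosedFieldType) (p n : nat) (alpha : C)
    (f : C -> 'cV[C]_p) :
  HG n f -> HG n (Rop alpha f).
Proof.
move=> [u ->].
pose g lam := \sum_(j < n.+1) 1 *: \sum_(i < j)
   alpha ^+ i *: (lam ^+ (j.-1 - i) *: submxcol u j).
have gH : HG n g.
  apply: HG_sum => j; apply: HG_sum => i; apply: HG_monom.
  by rewrite (leq_ltn_trans (leq_subr _ _))// (leq_ltn_trans (leq_pred _)).
rewrite (Rop_quotient gH)// => x; rewrite !HfunE -sumrB scaler_sumr.
apply: eq_bigr => j _; rewrite -scalerBl subrXX scale1r -scalerA; congr (_ *: _).
by rewrite scaler_suml; apply: eq_bigr => i _; rewrite scalerA mulrC.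
Qed.

Lemma HG_Sop (C : numClosedFieldType) (p n : nat) (alpha : C)
    (f : C -> 'cV[C]_p) :
  HG n f -> HG n (Sop alpha f).
Proof.
move=> fH; apply: HG_lin => //.
have -> : (fun lam => (1 - `|alpha| ^+ 2) *: Rop alpha f lam) =
          (fun lam => (1 - `|alpha| ^+ 2) *: Rop alpha f lam + 0).
  by apply/funext => x; rewrite addr0.
by apply: HG_lin; [exact: HG_Rop | exact: HG0].
Qed.

Lemma posdefmx_spectral (C : numClosedFieldType) (k : nat) (M : 'M[C]_k) :
  posdefmx M -> forall i, 0 < spectral_diag M 0 i.
Proof.
move=> [Mh Mpos] i; have /hermitian_normalmx/orthomx_spectralP ME := Mh.
set P := spectralmx M in ME; set d := spectral_diag M in ME *.
have PU : P \is unitarymx := spectral_unitarymx M.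
have PP : P *m P ^t* = 1%:M by apply/unitarymxP.
rewrite invmx_unitary// in ME.
have dE : diag_mx d = P *m M *m P ^t*.
  by rewrite ME !mulmxA PP mul1mx -mulmxA PP mulmx1.
have -> : d 0 i = diag_mx d i i by rewrite !mxE eqxx mulr1n.
pose e : 'cV[C]_k := delta_mx i 0.
have uN0 : P ^t* *m e != 0.
  apply/eqP => /(congr1 (mulmx P)); rewrite mulmxA PP mul1mx mulmx0.
  by move=> /matrixP/(_ i 0)/eqP; rewrite !mxE !eqxx oner_eq0.
have := Mpos _ uN0.
rewrite trmx_mul map_mxM trmxCK !mulmxA -(mulmxA _ P) -(mulmxA _ (P *m M)) -dE.
by rewrite trmx_delta map_delta_mx -rowE -colE !mxE.
Qed.

Lemma posdefmx_diag (C : numClosedFieldType) (k : nat) (P : 'M[C]_k)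
    (d : 'rV[C]_k) :
  P \is unitarymx -> (forall i, 0 < d 0 i) ->
  posdefmx (P ^t* *m diag_mx d *m P).
Proof.
move=> PU d0; split.
  apply/is_hermitianmxP; rewrite expr0 scale1r !trmx_mul !map_mxM trmxCK mulmxA.
  congr (_ *m _ *m _); rewrite tr_diag_mx map_diag_mx; congr diag_mx.
  apply/matrixP => i j; rewrite !mxE ord1; apply/esym/CrealP.
  exact/gtr0_real/d0.
move=> u uN0; set w := P *m u.
have wN0 : w != 0.
  apply: contraNneq uN0 => w0; apply/eqP.
  by rewrite -(mul1mx u) -(mulVmx (unitarymx_unit PU)) -mulmxA -/w w0 mulmx0.
have -> : u ^t* *m (P ^t* *m diag_mx d *m P) *m u = w ^t* *m (diag_mx d *m w).
  by rewrite /w trmx_mul map_mxM !mulmxA.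
clearbody w; rewrite mul_diag_mx !mxE.
have [i wi] : exists i, w i 0 != 0.
  apply/existsP; apply: contraNT wN0 => /existsPn w0.
  apply/eqP/matrixP => i j; rewrite ord1 mxE; apply/eqP.
  by move: (w0 i); rewrite negbK.
rewrite (bigD1 i)//= ltr_pwDl//.
  by rewrite !mxE mulrCA mulr_gt0// mulrC -normCK exprn_gt0// normr_gt0.
apply: sumr_ge0 => j _.
rewrite !mxE mulrCA mulr_ge0 ?(ltW (d0 j))//.
by rewrite mulrC -normCK exprn_ge0.
Qed.

Lemma invsqrtmx_posdef (C : numClosedFieldType) (k : nat) (M : 'M[C]_k) :
  posdefmx M -> posdefmx (invsqrtmx M).
Proof.
move=> /posdefmx_spectral d0; apply: posdefmx_diag => [|i].
  exact: (spectral_unitarymx M).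
by rewrite mxE invr_gt0 sqrtC_gt0.
Qed.

Lemma invsqrtmx_sqr (C : numClosedFieldType) (k : nat) (M : 'M[C]_k) :
  posdefmx M -> invsqrtmx M *m invsqrtmx M = invmx M.
Proof.
move=> Mpos; have d0 := posdefmx_spectral Mpos.
have [/hermitian_normalmx/orthomx_spectralP ME _] := Mpos.
have PU : spectralmx M \is unitarymx := spectral_unitarymx M.
rewrite invmx_unitary// in ME.
have PP : spectralmx M *m (spectralmx M) ^t* = 1%:M by apply/unitarymxP.
have PV : (spectralmx M) ^t* *m spectralmx M = 1%:M by apply: mulmx1C.
suff H : invsqrtmx M *m invsqrtmx M *m M = 1%:M.
  have MU : M \in unitmx by have [] := mulmx1_unit H.
  by rewrite -[LHS](mulmxK MU) H mul1mx.
rewrite [X in _ *m X]ME /invsqrtmx; set P := spectralmx M in PP PV *.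
rewrite !mulmxA.
rewrite -(mulmxA _ P (P ^t*)) PP mulmx1 -(mulmxA _ P (P ^t*)) PP mulmx1.
rewrite -(mulmxA (P ^t*)) mulmx_diag -(mulmxA (P ^t*)) mulmx_diag.
rewrite (_ : diag_mx _ = 1%:M) ?mulmx1//.
apply/matrixP => i j; rewrite !mxE; case: eqP => [->|]; last by rewrite !mulr0n.
by rewrite !mulr1n -invfM -expr2 sqrtCK mulVf// gt_eqF.
Qed.

(* Main.v *)
Require Import Defs.
From mathcomp Require Import all_boot all_order all_algebra.
From mathcomp Require Import complex.
From mathcomp Require Import all_classical all_reals all_analysis.
From mathcomp Require Import ring.
Set Implicit Arguments.
Unset Strict Implicit.
Unset Printing Implicit Defensive.
Import Order.TTheory GRing.Theory Num.Theory.
Import numFieldNormedType.Exports.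
Local Open Scope ring_scope.
Local Open Scope sesquilinear_scope.

(** The block shift A is the backward shift on coefficient vectors: from
    lam F(lam) A = F(lam) - F(0) ([Fmx_shift]) one gets
    F(lam) (I - lam A) = F(0), so that F(lam) is the resolvent row
    F(0) (I - lam A)^-1.  Everything is then algebra with the two commuting
    pencils Ba = I - al A and Bb = al^* I - A.

    Write Na and Nb for N_al and N_be, where be = 1 / al^*.  The columns of Na
    are coefficient vectors of polynomials vanishing at al, hence F(lam) Na is
    (lam - al) times F(lam) A Ba^-1 Na ([Fmx_root]), and likewise for Nb at be.
    Put X = Ba^-1 Na Ba^-^* and Y = Bb^-1 Nb Bb^-^*.  Dividing by the polynomial
    (lam - al) (1 - lam al^* ) on the left, and by its conjugate on the right,
    turns the two-variable identity st3 into A X A^* = A Y A^*; dividing st4 on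
    the left turns it into A X = A Y.  Both F(0) X and F(0) Y vanish, and a
    matrix M with F(0) M = 0 is determined by A M; hence each of the two is
    equivalent to X = Y ([kernel_identityP], [resolvent_identityP]).  So is st5,
    because Ba and Bb commute ([matrix_identityP]).

    Up to sign, S_al sends the coefficient vector Ba w to Bb w ([Sop_Hfun]), and
    Ba w runs over the polynomials vanishing at al as w runs over the kernel of
    F(0).  So the isometry says that the form of matrix Bb^* G Bb - Ba^* G Ba
    vanishes on the kernel of F(0).  This form has two readings.  The terms with
    a single factor A or A^* cancel, which leaves (1 - |al|^2) (A^* G A - G)
    ([defect_pencil]); polarized on the kernel of F(0), which is the range of
    A^*, its vanishing says that G is block Toeplitz ([toeplitz_isometry]).  On
    the other hand, T = Bb Ba^-1 maps ker F(al) onto ker F(be), and it is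
    isometric exactly when it carries the reproducing kernel of the first space
    to that of the second, T Na T^* = Nb ([kernel_transport]), which is X = Y
    again. *)

(** * Adjoints and positive definite matrices *)

Lemma adjmxM (C : numClosedFieldType) (m k l : nat) (X : 'M[C]_(m, k))
    (Y : 'M[C]_(k, l)) : (X *m Y) ^t* = Y ^t* *m X ^t*.
Proof. by rewrite trmx_mul map_mxM. Qed.

Lemma adjmxB (C : numClosedFieldType) (m k : nat) (X Y : 'M[C]_(m, k)) :
  (X - Y) ^t* = X ^t* - Y ^t*.
Proof. by rewrite linearB map_mxB. Qed.

Lemma adjmxN (C : numClosedFieldType) (m k : nat) (X : 'M[C]_(m, k)) :
  (- X) ^t* = - X ^t*.
Proof. by rewrite linearN map_mxN. Qed.

Lemma adjmxD (C : numClosedFieldType) (m k : nat) (X Y : 'M[C]_(m, k)) :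
  (X + Y) ^t* = X ^t* + Y ^t*.
Proof. by rewrite linearD map_mxD. Qed.

Lemma adjmxZ (C : numClosedFieldType) (m k : nat) (a : C) (X : 'M[C]_(m, k)) :
  (a *: X) ^t* = a^* *: X ^t*.
Proof. by rewrite linearZ map_mxZ. Qed.

Lemma adjmx1 (C : numClosedFieldType) (k : nat) : (1%:M : 'M[C]_k) ^t* = 1%:M.
Proof. by rewrite trmx1 map_mx1. Qed.

Lemma adjmxV (C : numClosedFieldType) (k : nat) (X : 'M[C]_k) :
  (invmx X) ^t* = invmx (X ^t*).
Proof. by rewrite trmx_inv map_invmx. Qed.

Lemma adjmx_inj (C : numClosedFieldType) (m k : nat) :
  injective (fun X : 'M[C]_(m, k) => X ^t*).
Proof. by move=> X Y /= XY; rewrite -[X]trmxCK XY trmxCK. Qed.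

Lemma adjmx_unit (C : numClosedFieldType) (k : nat) (X : 'M[C]_k) :
  X \in unitmx -> X ^t* \in unitmx.
Proof.
move=> XU; have := congr1 (fun Z => Z ^t*) (mulVmx XU).
by rewrite adjmxM adjmx1 => /mulmx1_unit [].
Qed.

Lemma posdefmx_adj (C : numClosedFieldType) (k : nat) (M : 'M[C]_k) :
  posdefmx M -> M ^t* = M.
Proof. by move=> [/is_hermitianmxP Mh _]; rewrite {2}Mh expr0 scale1r. Qed.

Lemma posdefmx_unit (C : numClosedFieldType) (k : nat) (M : 'M[C]_k) :
  posdefmx M -> M \in unitmx.
Proof.
move=> [_ Mpos]; rewrite -row_full_unit -cokermx_eq0; apply/eqP/matrixP => i j.
have [c0|cN0] := eqVneq (col j (cokermx M)) 0.
  by have /matrixP/(_ i 0) := c0; rewrite !mxE.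
have := Mpos _ cN0; rewrite -mulmxA colE (mulmxA M) mulmx_coker mul0mx mulmx0.
by rewrite mxE ltxx.
Qed.

(** Over a field containing a square root of -1 a sesquilinear form is
    determined by its diagonal values, Hermitian or not. *)
Lemma quadratic_form_eq0 (C : numClosedFieldType) (k : nat) (M : 'M[C]_k) :
  (forall x : 'cV[C]_k, (x ^t* *m M *m x) 0 0 = 0) -> M = 0.
Proof.
move=> M0; pose s (x y : 'cV[C]_k) := (x ^t* *m M *m y) 0 0.
have sE x y c : c * s x y + c^* * s y x = 0.
  have := M0 (x + c *: y); rewrite adjmxD adjmxZ !mulmxDl !mulmxDr.
  rewrite -!scalemxAr -!scalemxAl.
  have addE (X Y : 'M[C]_1) : (X + Y) 0 0 = X 0 0 + Y 0 0 by rewrite mxE.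
  have scaleE a (X : 'M[C]_1) : (a *: X) 0 0 = a * X 0 0 by rewrite mxE.
  by rewrite !addE !scaleE !M0 !mulr0 add0r addr0.
apply/matrixP => i j.
have sD : s (delta_mx i 0) (delta_mx j 0) = M i j.
  by rewrite /s trmx_delta map_delta_mx -rowE -colE !mxE.
have := sE (delta_mx i 0) (delta_mx j 0) 1.
have := sE (delta_mx i 0) (delta_mx j 0) 'i.
rewrite sD conjCi rmorph1 !mul1r mulNr -mulrBr => /eqP.
rewrite mulf_eq0 (negPf (neq0Ci C)) subr_eq0 => /eqP <-.
by rewrite -mulr2n mxE => /eqP; rewrite mulrn_eq0 => /eqP.
Qed.

(** * The backward block shift *)

Section BackwardShift.
Variables (C : numClosedFieldType) (p n : nat).
Local Notation F := (@Fmx C p n).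
Local Notation A := (shiftmx C p n).
Local Notation m := (bdim p n).

Lemma submxblockM (X Y : 'M[C]_m) (i j : 'I_n.+1) :
  submxblock (X *m Y) i j = \sum_k submxblock X i k *m submxblock Y k j.
Proof.
by rewrite -{1}[X]submxblockK -{1}[Y]submxblockK mul_mxblock mxblockK.
Qed.

Lemma submxblock_adj (X : 'M[C]_m) (i j : 'I_n.+1) :
  submxblock (X ^t*) i j = (submxblock X j i) ^t*.
Proof. by apply/matrixP => a b; rewrite !mxE. Qed.

Lemma submxblock_shift (i j : 'I_n.+1) :
  submxblock A i j = if j == i.+1 :> nat then 1%:M else 0.
Proof. by rewrite mxblockK. Qed.

(** Left multiplication by A moves block rows up by one, and by A^* moves them
    down; on the right the same happens to block columns with A and A^*
    exchanged. *)
Lemma submxblock_shiftM (M : 'M[C]_m) (i j : 'I_n.+1) :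
  submxblock (A *m M) i j =
  if (i < n)%N then submxblock M (inord i.+1) j else 0.
Proof.
rewrite submxblockM; under eq_bigr do rewrite submxblock_shift.
case: ifPn => [lt_in|ge_in].
  rewrite (bigD1 (inord i.+1))//= inordK ?ltnS// eqxx mul1mx big1 ?addr0//.
  move=> k kN; case: eqP => [e|]; rewrite ?mul0mx//.
  by case/eqP: kN; apply/val_inj; rewrite /= inordK.
rewrite big1// => k _; case: eqP => [e|]; rewrite ?mul0mx//.
by move: ge_in; rewrite -ltnS -e ltn_ord.
Qed.

Lemma submxblock_adjshiftM (M : 'M[C]_m) (i j : 'I_n.+1) :
  submxblock (A ^t* *m M) i j =
  if (0 < i)%N then submxblock M (inord i.-1) j else 0.
Proof.
have bE k : submxblock (A ^t*) i k = if i == k.+1 :> nat then 1%:M else 0.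
  by rewrite submxblock_adj submxblock_shift; case: ifP => _;
    rewrite ?adjmx1// trmx0 map_mx0.
rewrite submxblockM; under eq_bigr do rewrite bE.
case: ifPn => [i0|i0].
  have iE : (inord i.-1 : 'I_n.+1) = i.-1 :> nat.
    by rewrite inordK // (leq_ltn_trans (leq_pred _)).
  rewrite (bigD1 (inord i.-1))//= iE prednK// eqxx mul1mx big1 ?addr0//.
  move=> k kN; case: eqP => [e|]; rewrite ?mul0mx//.
  by case/eqP: kN; apply/val_inj; rewrite /= iE e.
rewrite big1// => k _; case: eqP => [e|]; rewrite ?mul0mx//.
by rewrite e in i0.
Qed.

Lemma submxblock_Mshift (M : 'M[C]_m) (i j : 'I_n.+1) :
  submxblock (M *m A) i j =
  if (0 < j)%N then submxblock M i (inord j.-1) else 0.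
Proof.
rewrite -[M *m A]trmxCK submxblock_adj adjmxM submxblock_adjshiftM.
by case: ifP => _; rewrite ?submxblock_adj ?trmxCK// trmx0 map_mx0.
Qed.

Lemma submxblock_Madjshift (M : 'M[C]_m) (i j : 'I_n.+1) :
  submxblock (M *m A ^t*) i j =
  if (j < n)%N then submxblock M i (inord j.+1) else 0.
Proof.
rewrite -[M *m _]trmxCK submxblock_adj adjmxM trmxCK submxblock_shiftM.
by case: ifP => _; rewrite ?submxblock_adj ?trmxCK// trmx0 map_mx0.
Qed.

Lemma shift_partial_isometry : A *m A ^t* *m A = A.
Proof.
apply/mxblockP => i j; rewrite -mulmxA submxblock_shiftM.
case: ifPn => [lt_in|ge_in].
  have iE : (inord i.+1 : 'I_n.+1) = i.+1 :> nat by rewrite inordK.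
  by rewrite submxblock_adjshiftM iE /= inord_val.
rewrite submxblock_shift; case: eqP => // e.
by move: ge_in; rewrite -ltnS -e ltn_ord.
Qed.

Lemma submxrowZ (k : nat) (a : C) (X : 'M[C]_(k, m)) (j : 'I_n.+1) :
  submxrow (a *: X) j = a *: submxrow X j.
Proof. by apply/matrixP => x y; rewrite !mxE. Qed.

(** Multiplying by lam undoes the backward shift, apart from the constant
    term that the shift drops. *)
Lemma Fmx_shift (lam : C) : lam *: (F lam *m A) = F lam - F 0.
Proof.
rewrite /Fmx mul_mxrow_mxblock; apply/mxrowP => j.
rewrite submxrowZ submxrowB !mxrowK.
case: (posnP j) => [j0|j_gt0].
  rewrite j0 !expr0 subrr big1 ?scaler0// => k _.
  by case: eqP; rewrite ?mulmx0// j0.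
have jE : (inord j.-1 : 'I_n.+1) = j.-1 :> nat.
  by rewrite inordK // (leq_ltn_trans (leq_pred _)).
rewrite (bigD1 (inord j.-1))//= jE prednK// eqxx mulmx1 big1 ?addr0.
  by rewrite scale_scalar_mx -exprS prednK// expr0n gtn_eqF// raddf0 subr0.
move=> k kN; case: eqP => [e|]; rewrite ?mulmx0//.
by case/eqP: kN; apply/val_inj; rewrite /= jE e.
Qed.

Lemma Fmx0_adjshift : F 0 *m A ^t* = 0.
Proof.
rewrite -[A ^t*]submxblockK /Fmx mul_mxrow_mxblock; apply/mxrowP => j.
rewrite mxrowK submxrow0 big1// => k _.
rewrite submxblock_adj submxblock_shift; case: eqP => [->|_].
  by rewrite expr0n raddf0 mul0mx.
by rewrite trmx0 map_mx0 mulmx0.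
Qed.

Lemma Fmx_adjF0 (lam : C) : F lam *m (F 0) ^t* = 1%:M.
Proof.
have -> : (F 0) ^t* = \mxcol_(j < n.+1) (0 ^+ j)%:M.
  rewrite /Fmx tr_mxrow; apply/matrixP => a b; rewrite !mxE.
  by rewrite rmorphMn /= rmorphXn rmorph0 eq_sym.
rewrite mul_mxrow_mxcol big_ord_recl !expr0 mulmx1 big1 ?addr0// => j _.
by rewrite expr0n raddf0 mulmx0.
Qed.

Lemma Fmx_poly (k : nat) (M : 'M[C]_(m, k)) (i : 'I_p) (j : 'I_k) :
  exists q : {poly C}, forall lam, (F lam *m M) i j = q.[lam].
Proof.
exists (\sum_(l < n.+1) submxcol (col j M) l i 0 *: 'X^l) => lam.
transitivity (Hfun (col j M) lam i 0).
  by rewrite /Hfun colE mulmxA -colE !mxE.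
rewrite HfunE horner_sum summxE; apply: eq_bigr => l _.
by rewrite hornerZ hornerXn !mxE mulrC.
Qed.

(** A polynomial identity may be divided by a nonzero polynomial factor even at
    the zeros of the factor, and the coefficients of F(lam) M are the entries
    of M. *)
Lemma Fmx_cancel (r : {poly C}) (k : nat) (M N : 'M[C]_(m, k)) : r != 0 ->
  (forall lam, r.[lam] *: (F lam *m M) = r.[lam] *: (F lam *m N)) -> M = N.
Proof.
move=> rN0 MN; apply/eqP; rewrite -subr_eq0; apply/eqP.
have FMN0 lam : F lam *m (M - N) = 0.
  apply/matrixP => i j; have [q qE] := Fmx_poly (M - N) i j.
  rewrite qE mxE; suff -> : q = 0 by rewrite horner0.
  have /eqP : r * q = 0.
    apply: poly_fun_eq0 => x; rewrite hornerM -qE.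
    have /eqP := MN x; rewrite -subr_eq0 -scalerBr -mulmxBr => /eqP.
    by move/matrixP => /(_ i j); rewrite [LHS]mxE => ->; rewrite mxE.
  by rewrite mulf_eq0 (negPf rN0) => /eqP.
apply/matrixP => i j.
have /Hfun_inj/matrixP/(_ i 0) : @Hfun C p n (col j (M - N)) = @Hfun C p n 0.
  by apply/funext => lam; rewrite /Hfun colE mulmxA FMN0 mul0mx mulmx0.
by rewrite [LHS]mxE => ->; rewrite !mxE.
Qed.

End BackwardShift.

(** * The resolvent of the shift and the operators R and S *)

Section Pencils.
Variables (C : numClosedFieldType) (p n : nat).
Local Notation F := (@Fmx C p n).
Local Notation A := (shiftmx C p n).
Local Notation m := (bdim p n).

Lemma Fmx_cancel2 (r : {poly C}) (M N : 'M[C]_m) : r != 0 ->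
  (forall lam om, (r.[lam] * r.[om]^*) *: (F lam *m M *m (F om) ^t*) =
                  (r.[lam] * r.[om]^*) *: (F lam *m N *m (F om) ^t*)) ->
  M = N.
Proof.
move=> rN0 MN; apply: adjmx_inj; apply: (Fmx_cancel rN0) => om.
rewrite -[LHS]trmxCK -[RHS]trmxCK; congr (_ ^t*).
rewrite !adjmxZ !adjmxM !trmxCK !scalemxAl.
rewrite -(trmxCK M) -(trmxCK N).
apply: (Fmx_cancel rN0) => lam; rewrite !trmxCK.
by rewrite -!scalemxAl -!scalemxAr !scalerA !mulmxA MN.
Qed.

Lemma Fmx_eq0 (k : nat) (M : 'M[C]_(m, k)) :
  (forall lam, F lam *m M = 0) -> M = 0.
Proof.
move=> M0; apply: (Fmx_cancel (N := 0) (oner_neq0 {poly C})) => lam.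
by rewrite M0 mulmx0.
Qed.

(** A keeps all the coefficients but the constant one, which F(0) reads. *)
Lemma shift_cancel (k : nat) (M N : 'M[C]_(m, k)) :
  A *m M = A *m N -> F 0 *m M = F 0 *m N -> M = N.
Proof.
move=> AMN FMN; apply/eqP; rewrite -subr_eq0; apply/eqP/Fmx_eq0 => lam.
rewrite -[F lam](subrK (F 0)) -Fmx_shift mulmxDl -scalemxAl -mulmxA.
by rewrite !mulmxBr AMN FMN !subrr scaler0 addr0.
Qed.

Lemma shift_left_cancel (k : nat) (M N : 'M[C]_(m, k)) :
  F 0 *m M = 0 -> F 0 *m N = 0 -> (A *m M = A *m N <-> M = N).
Proof.
by move=> FM FN; split=> [E|->//]; apply: shift_cancel E _; rewrite FM FN.
Qed.

(** The missing right-hand condition M F(0)^* = N F(0)^* comes for free from the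
    left-hand one, by taking adjoints. *)
Lemma shift_congruence_cancel (M N : 'M[C]_m) : M ^t* = M -> N ^t* = N ->
  F 0 *m M = 0 -> F 0 *m N = 0 ->
  (A *m M *m A ^t* = A *m N *m A ^t* <-> M = N).
Proof.
move=> Mh Nh FM FN; split=> [E|->//]; apply/(shift_left_cancel FM FN).
apply: adjmx_inj; apply: shift_cancel.
  by have := congr1 (fun Z => Z ^t*) E; rewrite !adjmxM !trmxCK.
by rewrite !adjmxM Mh Nh !mulmxA FM FN.
Qed.

(** The kernel of F(0) is the range of A^*, since the partial isometry A^* A is
    the projection that erases the constant coefficient. *)
Lemma shift_ker (k : nat) (M : 'M[C]_(m, k)) :
  F 0 *m M = 0 -> M = A ^t* *m (A *m M).
Proof.
move=> FM; apply: shift_cancel; first by rewrite !mulmxA shift_partial_isometry.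
by rewrite FM mulmxA Fmx0_adjshift mul0mx.
Qed.

Lemma Fmx_pencil (lam : C) : F lam *m (1%:M - lam *: A) = F 0.
Proof. by rewrite mulmxBr mulmx1 -scalemxAr Fmx_shift subKr. Qed.

(** A vector u with u = c A u satisfies (lam - c) F(lam) u = - c F(0) u for every
    lam, by [Fmx_shift]; at lam = c this gives c F(0) u = 0, and then the
    polynomial F(lam) u vanishes identically. *)
Lemma pencil_unit (c : C) : 1%:M - c *: A \in unitmx.
Proof.
rewrite -row_full_unit -cokermx_eq0; apply/eqP; set u := cokermx _.
have uE : u = c *: (A *m u).
  apply/eqP; rewrite -subr_eq0 scalemxAl -{1}[u]mul1mx -mulmxBl.
  by rewrite mulmx_coker.
have uF lam : (lam - c) *: (F lam *m u) = - (c *: (F 0 *m u)).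
  rewrite scalerBl {1}uE -!scalemxAr mulmxA scalerA mulrC -scalerA.
  rewrite (scalemxAl lam).
  by rewrite Fmx_shift mulmxBl scalerBr addrAC subrr add0r.
have XcN0 : 'X - c%:P != 0 by rewrite polyXsubC_eq0.
apply: (Fmx_cancel (N := 0) XcN0) => lam; rewrite mulmx0 scaler0 hornerXsubC uF.
by have := uF c; rewrite subrr scale0r => <-.
Qed.

Lemma Fmx_pencilV (lam : C) : F 0 *m invmx (1%:M - lam *: A) = F lam.
Proof. by rewrite -(Fmx_pencil lam) mulmxK// pencil_unit. Qed.

(** Resolvent identity for F(lam) = F(0) (I - lam A)^-1; it says that R_al acts
    on coefficient vectors as A (I - al A)^-1. *)
Lemma Fmx_difference_quotient (al lam : C) :
  F lam - F al = (lam - al) *: (F lam *m (A *m invmx (1%:M - al *: A))).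
Proof.
have BU := pencil_unit al; rewrite -[LHS](mulmxK BU) mulmxA scalemxAl.
congr (_ *m _); rewrite mulmxBl Fmx_pencil mulmxBr mulmx1 -scalemxAr.
by rewrite addrAC -Fmx_shift scalerBl.
Qed.

Lemma Fmx_root (al lam : C) (k : nat) (M : 'M[C]_(m, k)) : F al *m M = 0 ->
  F lam *m M =
  (lam - al) *: (F lam *m (A *m invmx (1%:M - al *: A) *m M)).
Proof.
move=> FM; rewrite mulmxA scalemxAl -Fmx_difference_quotient.
by rewrite mulmxBl FM subr0.
Qed.

Lemma Rop_Hfun (al : C) (u : 'cV[C]_m) :
  Rop al (Hfun u) = Hfun (A *m invmx (1%:M - al *: A) *m u).
Proof.
apply: (@Rop_quotient C p n); first by eexists.
move=> lam; rewrite /Hfun -mulmxBl Fmx_difference_quotient.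
by rewrite -scalemxAl !mulmxA.
Qed.

(** For f(lam) = (lam - al) g(lam) the function S_al f is (1 - lam al^* ) g(lam);
    the parametrization by w makes this visible without any inverse. *)
Lemma Sop_Hfun (al : C) (w : 'cV[C]_m) :
  Sop al (Hfun ((1%:M - al *: A) *m w)) = Hfun (- ((al^* *: 1%:M - A) *m w)).
Proof.
apply/funext => lam; rewrite /Sop Rop_Hfun -(mulmxA A).
rewrite (mulKmx (pencil_unit al)).
rewrite /Hfun (scalemxAr (- _)) (scalemxAr (1 - _)) -mulmxDr; congr (_ *m _).
rewrite normCK mulrC !mulmxBl mul1mx -!scalemxAl mul1mx.
rewrite scalerBr scalerBl scale1r !scaleNr scalerA opprB opprK.
by rewrite [A *m w - _]addrC addrA addrK addrC.
Qed.

End Pencils.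

(** * The matrices N as reproducing kernels *)

Section Kernels.
Variables (C : numClosedFieldType) (p n : nat).
Local Notation F := (@Fmx C p n).
Local Notation A := (shiftmx C p n).
Local Notation m := (bdim p n).
Variables (G : 'M[C]_m) (hG : posdefmx G) (be : C).
Local Notation N := (Nmx G be).

(** F(be) Gamma F(be)^* is the Gram matrix of evaluation at be; it is definite
    because F(be)^* is injective, with left inverse F(0) ([Fmx_adjF0]). *)
Lemma posdef_evaluation_gram : posdefmx (F be *m invmx G *m (F be) ^t*).
Proof.
have GU := posdefmx_unit hG; have Gh := posdefmx_adj hG; have [_ G0] := hG.
split=> [|x xN0].
  apply/is_hermitianmxP; rewrite expr0 scale1r -[RHS]/(_ ^t*).
  by rewrite !adjmxM trmxCK adjmxV Gh mulmxA.
pose y := invmx G *m (F be) ^t* *m x.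
have Gy : G *m y = (F be) ^t* *m x by rewrite /y -mulmxA mulKVmx.
have -> : x ^t* *m (F be *m invmx G *m (F be) ^t*) *m x = y ^t* *m G *m y.
  by rewrite -(mulmxA _ G) Gy /y !adjmxM trmxCK adjmxV Gh !mulmxA.
apply: G0; apply: contraNneq xN0 => y0.
have : F 0 *m (G *m y) = x.
  by rewrite Gy mulmxA -[F 0]trmxCK -adjmxM Fmx_adjF0 adjmx1 mul1mx.
by rewrite y0 !mulmx0 => <-.
Qed.

Lemma NmxE : N = invmx G - invmx G *m (F be) ^t* *m
  invmx (F be *m invmx G *m (F be) ^t*) *m (F be *m invmx G).
Proof.
have Gh := posdefmx_adj hG; have P := posdef_evaluation_gram.
rewrite /Nmx /zmx (adjmxM _ (invsqrtmx _)) (posdefmx_adj (invsqrtmx_posdef P)).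
by rewrite adjmxM trmxCK adjmxV Gh -(invsqrtmx_sqr P) !mulmxA.
Qed.

Lemma Nmx_adj : N ^t* = N.
Proof. by rewrite /Nmx adjmxB adjmxM trmxCK adjmxV (posdefmx_adj hG). Qed.

Lemma Fmx_Nmx : F be *m N = 0.
Proof.
rewrite NmxE mulmxBr !mulmxA mulmxV ?mul1mx ?subrr//.
exact: posdefmx_unit posdef_evaluation_gram.
Qed.

(** N G is the G-orthogonal projection onto ker F(be), i.e. F(lam) N F(om)^* is
    the reproducing kernel of the polynomials that vanish at be. *)
Lemma Nmx_reproducing (k : nat) (M : 'M[C]_(m, k)) :
  F be *m M = 0 -> N *m G *m M = M.
Proof.
move=> FM; have GU := posdefmx_unit hG; rewrite NmxE 2!mulmxBl mulVmx// mul1mx.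
by rewrite -!mulmxA mulKmx// FM !mulmx0 subr0.
Qed.

End Kernels.

(** * The three kernel identities *)

Section KernelIdentities.
Variables (C : numClosedFieldType) (p n : nat).
Local Notation F := (@Fmx C p n).
Local Notation A := (shiftmx C p n).
Local Notation m := (bdim p n).
Variables (G : 'M[C]_m) (hG : posdefmx G) (al : C) (al0 : al != 0).
Local Notation be := (1 / al^*).
Local Notation Na := (Nmx G al).
Local Notation Nb := (Nmx G be).
Local Notation Ba := (1%:M - al *: A).
Local Notation Bb := (al^* *: 1%:M - A).
Local Notation X := (invmx Ba *m Na *m invmx (Ba ^t*)).
Local Notation Y := (invmx Bb *m Nb *m invmx (Bb ^t*)).

(** Numerator times denominator of the Blaschke factor
    (lam - al) / (1 - lam al^* ): the common factor of both sides of the kernel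
    identities. *)
Definition blaschke_poly : {poly C} := ('X - al%:P) * (1 - al^* *: 'X).

Lemma horner_blaschke lam :
  blaschke_poly.[lam] = (lam - al) * (1 - lam * al^*).
Proof. by rewrite /blaschke_poly !hornerE mulrC [al^* * _]mulrC mulrC. Qed.

Lemma conjC_al_neq0 : al^* != 0. Proof. by rewrite conjC_eq0. Qed.

Lemma blaschke_poly_neq0 : blaschke_poly != 0.
Proof.
rewrite mulf_neq0 ?polyXsubC_eq0//; apply/eqP => /(congr1 (horner^~ 0)) /eqP.
by rewrite !hornerE /= subr0 oner_eq0.
Qed.

Lemma reflected_pencilE : Bb = al^* *: (1%:M - be *: A).
Proof. by rewrite scalerBr scalerA mul1r divff ?conjC_al_neq0// scale1r. Qed.

Lemma reflected_pencil_unit : Bb \in unitmx.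
Proof.
by rewrite reflected_pencilE unitmxZ ?unitfE ?conjC_al_neq0// pencil_unit.
Qed.

Lemma reflected_pencilV : invmx Bb = be *: invmx (1%:M - be *: A).
Proof.
have BU := reflected_pencil_unit.
apply: (can_inj (mulKmx BU)); rewrite mulmxV// reflected_pencilE.
rewrite -scalemxAl -scalemxAr scalerA mulmxV ?pencil_unit//.
by rewrite mul1r divff ?conjC_al_neq0// scale1r.
Qed.

Lemma Fmx_reflected_pencil : F be *m Bb = al^* *: F 0.
Proof. by rewrite reflected_pencilE -scalemxAr Fmx_pencil. Qed.

Lemma pencil_comm : Ba *m Bb = Bb *m Ba.
Proof.
rewrite !mulmxBl !mulmxBr -!scalemxAl -!scalemxAr !mul1mx !mulmx1 !opprB.
rewrite !scalerA [al * _]mulrC addrACA [RHS]addrACA.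
by rewrite [- A - _]addrC.
Qed.

Lemma Fmx_Nmx_divide lam : (1 - lam * al^*) *: (F lam *m Na) =
  blaschke_poly.[lam] *: (F lam *m (A *m invmx Ba *m Na)).
Proof.
by rewrite (Fmx_root lam (Fmx_Nmx hG al)) scalerA horner_blaschke mulrC.
Qed.

(** Division at the root be; the factor lam - be is 1 - lam al^* up to the
    constant - al^*, whence the sign. *)
Lemma Fmx_Nmx_divide_reflected lam : (lam - al) *: (F lam *m Nb) =
  - (blaschke_poly.[lam] *: (F lam *m (A *m invmx Bb *m Nb))).
Proof.
rewrite (Fmx_root lam (Fmx_Nmx hG be)) reflected_pencilV.
rewrite -!scalemxAr -!scalemxAl -!scalemxAr !scalerA horner_blaschke.
rewrite -[RHS]scaleNr.
congr (_ *: _); rewrite -[RHS]mulrN -[RHS]mulrA; congr (_ * _).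
by rewrite mulrN mulrBl !mul1r mulfK ?conjC_al_neq0// opprB.
Qed.

(** Division on both sides: the right-hand factor is the adjoint of the
    left-hand division at om. *)
Lemma kernel_divide lam om :
  ((1 - lam * al^*) * (1 - al * om^*)) *: (F lam *m Na *m (F om) ^t*) =
  (blaschke_poly.[lam] * blaschke_poly.[om]^*) *:
     (F lam *m (A *m X *m A ^t*) *m (F om) ^t*).
Proof.
have R : (1 - al * om^*) *: (Na *m (F om) ^t*) = blaschke_poly.[om]^* *:
    (Na *m invmx (Ba ^t*) *m A ^t* *m (F om) ^t*).
  apply: adjmx_inj; have := Fmx_Nmx_divide om.
  rewrite !adjmxZ !adjmxM !adjmxV !trmxCK (Nmx_adj hG) conjCK.
  by rewrite rmorphB rmorphM /= conjC1 conjCK [al^* * _]mulrC !mulmxA.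
rewrite -scalerA -mulmxA scalemxAr R -scalemxAr scalerA mulrC -[LHS]scalerA.
rewrite !mulmxA -!mulmxA (mulmxA (F lam) Na) (scalemxAl (1 - lam * _)).
rewrite Fmx_Nmx_divide.
by rewrite -scalemxAl scalerA [_^* * _]mulrC !mulmxA.
Qed.

Lemma kernel_divide_reflected lam om :
  ((lam - al) * (om^* - al^*)) *: (F lam *m Nb *m (F om) ^t*) =
  (blaschke_poly.[lam] * blaschke_poly.[om]^*) *:
     (F lam *m (A *m Y *m A ^t*) *m (F om) ^t*).
Proof.
have R : (om^* - al^*) *: (Nb *m (F om) ^t*) = - (blaschke_poly.[om]^* *:
    (Nb *m invmx (Bb ^t*) *m A ^t* *m (F om) ^t*)).
  apply: adjmx_inj; have := Fmx_Nmx_divide_reflected om; rewrite -scaleNr => E.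
  rewrite -scaleNr !adjmxZ !adjmxM !adjmxV !trmxCK (Nmx_adj hG).
  rewrite rmorphN /= conjCK.
  by rewrite -rmorphB /= conjCK E !mulmxA.
rewrite -scalerA -mulmxA scalemxAr R -scaleNr -scalemxAr scalerA mulrC.
rewrite -[LHS]scalerA.
rewrite !mulmxA -!mulmxA (mulmxA (F lam) Nb) (scalemxAl (lam - al)).
rewrite Fmx_Nmx_divide_reflected -scaleNr.
by rewrite -scalemxAl scalerA mulrNN [_^* * _]mulrC !mulmxA.
Qed.

(** F(0) Ba^-1 = F(al) annihilates Na; for Y, the row F(0) Bb^-1 is a multiple
    of F(be). *)
Lemma Fmx0_compress : F 0 *m X = 0.
Proof. by rewrite !mulmxA Fmx_pencilV (Fmx_Nmx hG) mul0mx. Qed.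

Lemma Fmx0_compress_reflected : F 0 *m Y = 0.
Proof.
rewrite !mulmxA reflected_pencilV -scalemxAr Fmx_pencilV -!scalemxAl.
by rewrite (Fmx_Nmx hG) mul0mx scaler0.
Qed.

Lemma compress_adj : X ^t* = X.
Proof. by rewrite !adjmxM !adjmxV trmxCK (Nmx_adj hG) mulmxA. Qed.

Lemma compress_reflected_adj : Y ^t* = Y.
Proof. by rewrite !adjmxM !adjmxV trmxCK (Nmx_adj hG) mulmxA. Qed.

Lemma kernel_identityP : (forall lam om,
    ((1 - lam * al^*) * (1 - al * om^*)) *: (F lam *m Na *m (F om) ^t*) =
    ((lam - al) * (om^* - al^*)) *: (F lam *m Nb *m (F om) ^t*)) <-> X = Y.
Proof.
rewrite -(shift_congruence_cancel compress_adj compress_reflected_adj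
  Fmx0_compress Fmx0_compress_reflected).
split=> [E|E lam om]; last by rewrite kernel_divide kernel_divide_reflected E.
apply: (Fmx_cancel2 blaschke_poly_neq0) => lam om.
by rewrite -kernel_divide -kernel_divide_reflected.
Qed.

Lemma resolvent_identityP : (forall lam,
    (1 - lam * al^*) *: (F lam *m Na *m invmx (Ba ^t*)) =
    - ((lam - al) *: (F lam *m Nb *m invmx (Bb ^t*)))) <-> X = Y.
Proof.
have LE lam : (1 - lam * al^*) *: (F lam *m Na *m invmx (Ba ^t*)) =
    blaschke_poly.[lam] *: (F lam *m (A *m X)).
  by rewrite scalemxAl Fmx_Nmx_divide -scalemxAl !mulmxA.
have RE lam : - ((lam - al) *: (F lam *m Nb *m invmx (Bb ^t*))) =
    blaschke_poly.[lam] *: (F lam *m (A *m Y)).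
  by rewrite scalemxAl Fmx_Nmx_divide_reflected mulNmx opprK -scalemxAl !mulmxA.
rewrite -(shift_left_cancel Fmx0_compress Fmx0_compress_reflected).
split=> [E|E lam]; last by rewrite LE RE E.
by apply: (Fmx_cancel blaschke_poly_neq0) => lam; rewrite -LE -RE.
Qed.

Lemma unit_congruence (U M N : 'M[C]_m) : U \in unitmx ->
  invmx U *m M *m invmx (U ^t*) = N <-> M = U *m N *m U ^t*.
Proof.
move=> UU; have UU' := adjmx_unit UU; split=> [<-|->].
  by rewrite !mulmxA mulmxV// mul1mx mulmxKV.
by rewrite !mulmxA mulVmx// mul1mx mulmxK.
Qed.

Local Notation T := (Bb *m invmx Ba).

(** T is the matrix of - S_al on the polynomials vanishing at al, so this form
    of X = Y says that S_al carries one reproducing kernel to the other. *)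
Lemma compress_eq_transport : X = Y <-> T *m Na *m T ^t* = Nb.
Proof.
have -> : T *m Na *m T ^t* = Bb *m X *m Bb ^t* by rewrite adjmxM adjmxV !mulmxA.
have [YX XY] := unit_congruence Nb X reflected_pencil_unit.
by split=> [/esym/YX/esym|/esym/XY/esym].
Qed.

Lemma matrix_identityP : Bb *m Na *m Bb ^t* = Ba *m Nb *m Ba ^t* <-> X = Y.
Proof.
have aU := pencil_unit p n al; rewrite compress_eq_transport.
have TE : T = invmx Ba *m Bb.
  by apply: (can_inj (mulKmx aU)); rewrite mulKVmx// mulmxA pencil_comm mulmxK.
rewrite TE adjmxM adjmxV; move: (Na) (Nb) => N1 N2.
have -> : invmx Ba *m Bb *m N1 *m (Bb ^t* *m invmx (Ba ^t*)) =
    invmx Ba *m (Bb *m N1 *m Bb ^t*) *m invmx (Ba ^t*) by rewrite !mulmxA.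
exact: iff_sym (unit_congruence _ _ aU).
Qed.

End KernelIdentities.

(** * Isometry of S on the polynomials vanishing at a point *)

Section Isometry.
Variables (C : numClosedFieldType) (p n : nat).
Local Notation F := (@Fmx C p n).
Local Notation A := (shiftmx C p n).
Local Notation m := (bdim p n).

(** For i, j < n the block (i, j) of the matrix on the right is
    g_(i,j) - g_(i+1,j+1), and the last block row and column vanish.  So it is
    zero exactly when G is constant along its block diagonals. *)
Lemma block_toeplitzP (G : 'M[C]_m) :
  block_toeplitz G <-> A *m (A ^t* *m G *m A - G) *m A ^t* = 0.
Proof.
have succ_lt (i : 'I_n.+1) : (i < n)%N -> (inord i.+1 : 'I_n.+1) = i.+1 :> nat.
  by move=> lt_in; rewrite inordK.
have blockE (i j : 'I_n.+1) :
    submxblock (A *m (A ^t* *m G *m A - G) *m A ^t*) i j =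
    if (i < n)%N && (j < n)%N then
      submxblock G i j - submxblock G (inord i.+1) (inord j.+1) else 0.
  rewrite submxblock_Madjshift submxblock_shiftM.
  case: (ltnP j n) => [lt_jn|]; rewrite ?andbF//.
  case: (ltnP i n) => [lt_in|]//=.
  rewrite submxblockB submxblock_Mshift succ_lt//= inord_val.
  by rewrite submxblock_adjshiftM succ_lt//= inord_val.
split=> [[t tE]|E].
  apply/mxblockP => i j; rewrite blockE submxblock0.
  case: ifP => // /andP[lt_i lt_j].
  rewrite !tE !succ_lt// -[i.+1%:Z]/(Posz i.+1) !intS.
  by rewrite opprD addrACA subrr add0r subrr.
have step (i j : nat) : (i < n)%N -> (j < n)%N ->
    submxblock G (inord i) (inord j) = submxblock G (inord i.+1) (inord j.+1).
  move=> lt_in lt_jn; have := blockE (inord i) (inord j).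
  have vE (k : nat) : (k < n)%N -> (inord k : 'I_n.+1) = k :> nat.
    by move=> lt_kn; rewrite inordK// ltnS ltnW.
  rewrite E submxblock0 (vE i)// (vE j)//.
  by rewrite lt_in lt_jn /= => /esym/eqP; rewrite subr_eq0 => /eqP.
have slide (k i j : nat) : (i + k <= n)%N -> (j + k <= n)%N ->
    submxblock G (inord (i + k)) (inord (j + k)) =
    submxblock G (inord i) (inord j).
  elim: k => [|k IHk]; first by rewrite !addn0.
  by rewrite !addnS => le_i le_j; rewrite -step// IHk// ltnW.
(* Each diagonal is represented by its block in the first column or row. *)
exists (fun z => match z with
  | Posz k => submxblock G (inord k) (inord 0)
  | Negz k => submxblock G (inord 0) (inord k.+1) end) => i j.
have le_n (k : 'I_n.+1) : (k <= n)%N by rewrite -ltnS.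
case: (leqP j i) => [le_ji|lt_ij].
  rewrite subzn//; have := slide j (i - j)%N 0.
  by rewrite subnK// add0n !inord_val; apply.
have -> : i%:Z - j%:Z = Negz (j - i).-1.
  by rewrite NegzE prednK ?subn_gt0// -subzn ?(ltnW lt_ij)// opprB.
rewrite prednK ?subn_gt0//; have := slide i 0%N (j - i)%N.
by rewrite subnK ?(ltnW lt_ij)// add0n !inord_val; apply.
Qed.

Lemma quadratic_form_range (k : nat) (E : 'M[C]_(k, m)) (P M : 'M[C]_m) :
  E *m P = 0 ->
  (forall w : 'cV[C]_m, E *m w = 0 -> exists x : 'cV[C]_m, w = P *m x) ->
  (forall w : 'cV[C]_m, E *m w = 0 -> (w ^t* *m M *m w) 0 0 = 0) <->
  P ^t* *m M *m P = 0.
Proof.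
move=> EP rangeP; split=> [M0|M0 w /rangeP[x ->]].
  apply: quadratic_form_eq0 => x; have := M0 (P *m x).
  by rewrite mulmxA EP mul0mx adjmxM !mulmxA; apply.
have -> : (P *m x) ^t* *m M *m (P *m x) = x ^t* *m (P ^t* *m M *m P) *m x.
  by rewrite adjmxM !mulmxA.
by rewrite M0 mulmx0 mul0mx mxE.
Qed.

(** Let N and N' be the reproducing kernels of ker E and ker E' for the inner
    product G, and let T be a bijection from the first kernel to the second.
    Then T is isometric iff T N T^* is reproducing on ker E', and a Hermitian
    reproducing kernel is unique.  Isometry is phrased after polarization, using
    that ker E is the range of N. *)
Lemma kernel_transport (k : nat) (E E' : 'M[C]_(k, m)) (G N N' T : 'M[C]_m)
    (c : C) :
  T \in unitmx -> c != 0 -> E' *m T = c *: E ->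
  G ^t* = G -> N ^t* = N -> N' ^t* = N' -> E *m N = 0 -> E' *m N' = 0 ->
  (forall M : 'M[C]_m, E *m M = 0 -> N *m G *m M = M) ->
  (forall M : 'M[C]_m, E' *m M = 0 -> N' *m G *m M = M) ->
  N *m (T ^t* *m G *m T - G) *m N = 0 <-> T *m N *m T ^t* = N'.
Proof.
move=> TU c0 ET Gh Nh Nh' EN EN' repN repN'.
rewrite mulmxBr mulmxBl repN//; split=> [/eqP|TN]; last first.
  have /repN' : E' *m (T *m N) = 0 by rewrite mulmxA ET -scalemxAl EN scaler0.
  rewrite -TN => TNE; apply/eqP; rewrite subr_eq0; apply/eqP.
  by apply: (can_inj (mulKmx TU)); rewrite -[RHS]TNE !mulmxA.
rewrite subr_eq0 => /eqP isoN; set M := T *m N *m T ^t*.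
(* N' reproduces the columns of M, and M those of N'; adjoints then give
   M = N'. *)
have N'M : N' *m G *m M = M.
  by apply: repN'; rewrite /M !mulmxA ET -!scalemxAl EN mul0mx scaler0.
have [V N'E] : exists V, N' = T *m (N *m G *m V).
  exists (invmx T *m N'); rewrite repN ?mulKVmx//; apply: (scalerI c0).
  by rewrite scalemxAl -ET mulmxA mulmxK// EN' scaler0.
have MN' : M *m G *m N' = N' by rewrite N'E -[in RHS]isoN /M !mulmxA.
have Mh : M ^t* = M by rewrite /M !adjmxM trmxCK Nh mulmxA.
clearbody M; have := congr1 (fun Z => Z ^t*) N'M.
by rewrite /= !adjmxM Mh Gh Nh' mulmxA MN'.
Qed.

Lemma Sop_isometryP (G : 'M[C]_m) (al : C) :
  (forall f : C -> 'cV[C]_p, HG_at n al f ->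
     Hdot G (Sop al f) (Sop al f) = Hdot G f f) <->
  (forall w : 'cV[C]_m, F 0 *m w = 0 ->
     (w ^t* *m ((al^* *: 1%:M - A) ^t* *m G *m (al^* *: 1%:M - A) -
      (1%:M - al *: A) ^t* *m G *m (1%:M - al *: A)) *m w) 0 0 = 0).
Proof.
set Ba := 1%:M - al *: A; set Bb := al^* *: 1%:M - A.
have subE (X Y : 'M[C]_1) : (X - Y) 0 0 = X 0 0 - Y 0 0 by rewrite !mxE.
have dotE (w : 'cV[C]_m) :
    (w ^t* *m (Bb ^t* *m G *m Bb - Ba ^t* *m G *m Ba) *m w) 0 0 =
    Hdot G (Sop al (Hfun (Ba *m w))) (Sop al (Hfun (Ba *m w))) -
    Hdot G (Hfun (Ba *m w)) (Hfun (Ba *m w)).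
  rewrite Sop_Hfun !HdotE -/Bb adjmxN !mulNmx mulmxN opprK.
  by rewrite !adjmxM mulmxBr mulmxBl !mulmxA subE.
split=> [iso w Fw|iso _ [[u ->] Fu]].
  apply/eqP; rewrite dotE subr_eq0 iso//; split; first by eexists.
  by rewrite /Hfun mulmxA Fmx_pencil.
have := iso (invmx Ba *m u); rewrite dotE mulKVmx ?pencil_unit//.
rewrite mulmxA Fmx_pencilV => /(_ Fu)/eqP.
by rewrite subr_eq0 => /eqP.
Qed.

End Isometry.

(** * The Toeplitz property as an isometry *)

Section ToeplitzCharacterisation.
Variables (C : numClosedFieldType) (p n : nat).
Local Notation F := (@Fmx C p n).
Local Notation A := (shiftmx C p n).
Local Notation m := (bdim p n).
Variables (G : 'M[C]_m) (hG : posdefmx G) (al : C) (al0 : al != 0).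
Local Notation Ba := (1%:M - al *: A).
Local Notation Bb := (al^* *: 1%:M - A).

(** Matrix form of
    |al^* - a|^2 - |1 - al a|^2 = (1 - |al|^2) (|a|^2 - 1). *)
Lemma defect_pencil :
  Bb ^t* *m G *m Bb - Ba ^t* *m G *m Ba =
  (1 - `|al| ^+ 2) *: (A ^t* *m G *m A - G).
Proof.
rewrite !adjmxB !adjmxZ !adjmx1 conjCK normCK.
rewrite !mulmxBl !mulmxBr -?scalemxAl -?scalemxAr -?scalemxAl -?scalemxAr.
rewrite ?mul1mx ?mulmx1.
move: (A ^t* *m G) (G *m A) (A ^t* *m G *m A) => AG GA AGA.
by apply/matrixP => i j; rewrite !mxE; ring.
Qed.

Lemma toeplitz_isometry : `|al| < 1 ->
  block_toeplitz G <->
  (forall f : C -> 'cV[C]_p, HG_at n al f ->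
     Hdot G (Sop al f) (Sop al f) = Hdot G f f).
Proof.
move=> al1; rewrite Sop_isometryP block_toeplitzP defect_pencil.
have dN0 : 1 - `|al| ^+ 2 != 0.
  by rewrite subr_eq0 eq_sym lt_eqF// expr_lt1.
rewrite (quadratic_form_range _ (Fmx0_adjshift C p n)) ?trmxCK.
  rewrite -scalemxAr -scalemxAl; split=> [->|/eqP]; first by rewrite scaler0.
  by rewrite scaler_eq0 (negPf dN0) => /eqP.
by move=> w Fw; exists (A *m w); exact: shift_ker.
Qed.

(** Here the form of the isometry is polarized on ker F(al), the range of N_al,
    rather than on ker F(0) as for the Toeplitz property. *)
Lemma isometry_matrix_identity :
  (forall f : C -> 'cV[C]_p, HG_at n al f ->
     Hdot G (Sop al f) (Sop al f) = Hdot G f f) <->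
  Bb *m Nmx G al *m Bb ^t* = Ba *m Nmx G (1 / al^*) *m Ba ^t*.
Proof.
have aU := pencil_unit p n al; have bU := reflected_pencil_unit p n al0.
have Gh := posdefmx_adj hG; pose T := Bb *m invmx Ba.
rewrite Sop_isometryP (matrix_identityP G al0) (compress_eq_transport G al0).
rewrite -/T.
have TU : T \in unitmx by rewrite unitmx_mul bU unitmx_inv.
have FT : F (1 / al^*) *m T = al^* *: F al.
  by rewrite /T mulmxA Fmx_reflected_pencil// -scalemxAl Fmx_pencilV.
rewrite -(kernel_transport TU (conjC_al_neq0 al0) FT Gh (Nmx_adj hG al)
  (Nmx_adj hG _) (Fmx_Nmx hG al) (Fmx_Nmx hG _)
  (@Nmx_reproducing _ _ _ _ hG al m) (@Nmx_reproducing _ _ _ _ hG _ m)).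
rewrite -{1}(Nmx_adj hG al).
rewrite -(quadratic_form_range _ (Fmx_Nmx hG al)); last first.
  by move=> w Fw; exists (G *m w); rewrite mulmxA Nmx_reproducing.
have E : Ba ^t* *m (T ^t* *m G *m T - G) *m Ba =
    Bb ^t* *m G *m Bb - Ba ^t* *m G *m Ba.
  rewrite (mulmxBr (Ba ^t*)) (mulmxBl _ _ Ba); congr (_ - _).
  rewrite /T adjmxM adjmxV !mulmxA mulmxV ?adjmx_unit// mul1mx.
  by rewrite mulmxKV.
rewrite -E; split=> iso u Fu.
  have /iso : F 0 *m (invmx Ba *m u) = 0 by rewrite mulmxA Fmx_pencilV.
  by rewrite adjmxM adjmxV !mulmxA mulmxKV ?adjmx_unit// mulmxK.
have /iso : F al *m (Ba *m u) = 0 by rewrite mulmxA Fmx_pencil.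
by rewrite adjmxM !mulmxA.
Qed.

End ToeplitzCharacterisation.

Theorem theorem5p2 (R : realType) (p n : nat) (hp : (1 <= p)%N)
  (hn : (1 <= n)%N) (G : 'M[R[i]]_(bdim p n)) (hG : posdefmx G) :
  let F := @Fmx R[i] p n in
  let A := shiftmx R[i] p n in
  let N := Nmx G in
  let Id := 1%:M : 'M[R[i]]_(bdim p n) in
  let st3 (alpha : R[i]) := forall lam om : R[i],
    ((1 - lam * alpha^*) * (1 - alpha * om^*)) *:
      (F lam *m N alpha *m (F om) ^t*) =
    ((lam - alpha) * (om^* - alpha^*)) *:
      (F lam *m N (1 / alpha^*) *m (F om) ^t*) in
  let st4 (alpha : R[i]) := forall lam : R[i],
    (1 - lam * alpha^*) *:
      (F lam *m N alpha *m invmx (Id - alpha^* *: A ^t*)) =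
    - ((lam - alpha) *:
      (F lam *m N (1 / alpha^*) *m invmx (alpha *: Id - A ^t*))) in
  let st5 (alpha : R[i]) :=
    (alpha^* *: Id - A) *m N alpha *m (alpha *: Id - A ^t*) =
    (Id - alpha *: A) *m N (1 / alpha^*) *m (Id - alpha^* *: A ^t*) in
  (forall alpha : R[i], `|alpha| < 1 -> alpha != 0 ->
     [<-> block_toeplitz G;
          forall f : R[i] -> 'cV[R[i]]_p, HG_at n alpha f ->
            Hdot G (Sop alpha f) (Sop alpha f) = Hdot G f f;
          st3 alpha;
          st4 alpha;
          st5 alpha])
  /\
  (forall alpha : R[i], alpha != 0 ->
     [<-> st3 alpha; st4 alpha; st5 alpha]).
Proof.
move=> F A N Id st3 st4 st5.
have aE (al : R[i]) : Id - al^* *: A ^t* = (1%:M - al *: A) ^t*.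
  by rewrite adjmxB adjmxZ adjmx1.
have bE (al : R[i]) : al *: Id - A ^t* = (al^* *: 1%:M - A) ^t*.
  by rewrite adjmxB adjmxZ adjmx1 conjCK.
have eqv (al : R[i]) : al != 0 -> (st3 al <-> st5 al) /\ (st4 al <-> st5 al).
  move=> al0; rewrite /st4 /st5 aE bE (matrix_identityP G al0).
  split; first exact: (kernel_identityP hG al0).
  exact: (resolvent_identityP hG al0).
split=> [al al1 al0|al al0]; have [[s35 s53] [s45 s54]] := eqv _ al0;
  last first.
  by tfae; [move/s35/s54 | exact: s45 | exact: s53].
have [t2 t1] := toeplitz_isometry G al1.
have [u5 u2] : (forall f : R[i] -> 'cV[R[i]]_p, HG_at n al f ->
    Hdot G (Sop al f) (Sop al f) = Hdot G f f) <-> st5 al.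
  by rewrite /st5 aE bE; exact: (isometry_matrix_identity hG al0).
by tfae; [exact: t2 | move/u5/s53 | move/s35/s54 | exact: s45 | move/u2/t1].
Qed.
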